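(* Let $p$ be any prime. Then for all $n=1,\ldots,p-1$ we have $$B_n\equiv\sum_{m=1}^{p-1}(-1)^m D_{m-1}\,(-m)^n\pmod p,$$ where $B_n$ denotes the $n$th Bell number and $D_n$ denotes the $n$th derangement number.
   Context: The Bell number $B_n$ is the number of partitions of a set of cardinality $n$ (with $B_0=1$). The derangement number $D_n$ is the number of fixed-point-free permutations of a set of cardinality $n$ (with $D_0=1$); equivalently $\frac{D_n}{n!}=\sum_{k=0}^n\frac{(-1)^k}{k!}$ for $n=0,1,2,\ldots$. *)

(* Defs.v *)
From mathcomp Require Import all_boot all_order all_fingroup all_algebra.
Set Implicit Arguments.
Unset Strict Implicit.
Unset Printing Implicit Defensive.

(* [partition P D] requires the blocks in [P] to be nonempty; for [n = 0] the
   empty family is the only partition, so [bell 0 = 1]. *)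
Definition bell (n : nat) : nat :=
  #|[set P : {set {set 'I_n}} | partition P [set: 'I_n]]|.

Definition derangement (n : nat) : nat :=
  #|[set s : 'S_n | [forall i, s i != i]]|.

(* Main.v *)
(** Counting functions 'I_n -> 'I_m by their kernel partition gives
    m ^ n = \sum_P m ^_ #|P| over the partitions P of 'I_n. So B_n equals
    \sum_j w_j * j ^ n as soon as \sum_j w_j * j ^_ k = 1 for all k <= n.
    Modulo p the weights w_j = (-1) ^ (p - j) * D_(p - 1 - j), 0 <= j < p, have
    this property for all k < p: the recurrence D_(d+1) = (d+1) D_d + (-1)^(d+1)
    becomes (j + 1) w_(j+1) = w_j + 1, so that consecutive factorial moments
    differ by \sum_(j < p) j ^_ k = p ^_ (k+1) / (k+1) = 0, and the moment of
    order p - 1 is w_(p-1) (p-1)! = 1 by Wilson. The theorem follows by the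
    substitution m = p - j; the term j = 0 vanishes because n > 0. *)

Require Import Defs.
From mathcomp Require Import all_boot all_order all_fingroup all_algebra.
From mathcomp Require Import ring zify.
Import GRing.Theory Num.Theory.
Local Open Scope ring_scope.

(** A function with kernel [P] factors uniquely through the map sending a point to its block, and
    the induced map on blocks is injective; so these functions correspond to the injections from [P]
    to [R]. *)
Lemma card_preim_partition (T R : finType) (P : {set {set T}}) :
  partition P [set: T] ->
  #|[set f : {ffun T -> R} | preim_partition f [set: T] == P]| =
    (#|R| ^_ #|P|)%N.
Proof.
move=> partP; have [/eqP coverP trivP notP0] := and3P partP.
have blockP x : pblock P x \in P by rewrite pblock_mem // coverP inE.
pose pi x : {B | B \in P} := Sub (pblock P x) (blockP x).
(* Blocks are nonempty, so [r] can choose a point in each. *)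
have [r rK] : {r | cancel r pi}.
  suff inh (B : {B | B \in P}) : {x | x \in val B}.
    exists (fun B => sval (inh B)) => B; apply: val_inj.
    by rewrite /= (def_pblock trivP (valP B)) // (svalP (inh B)).
  apply: sigW; apply/set0Pn; apply: contraNneq notP0 => <-; exact: valP.
have fibreE (f : {ffun T -> R}) :
    reflect (forall x y, (f x == f y) = (pi x == pi y))
            (preim_partition f [set: T] == P).
  apply: (iffP eqP) => [defP x y | ker_f].
    rewrite -[pi x == _]/(pblock P x == pblock P y) eq_pblock ?coverP ?inE //.
    rewrite -{1}defP pblock_equivalence_partition ?inE //.
    by split=> // /eqP->.
  rewrite -[RHS](preim_partition_pblock partP); apply: eq_in_imset => x _.
  by apply/setP=> y; rewrite !inE ker_f.
pose lift (g : {ffun {B | B \in P} -> R}) : {ffun T -> R} :=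
  [ffun x => g (pi x)].
rewrite -[#|P|]card_sig -card_inj_ffuns -(card_imset (f := lift)) => [|g h].
  apply: eq_card => f; rewrite inE; apply/fibreE/imsetP => [ker_f | [g]].
    exists [ffun B => f (r B)].
      rewrite inE; apply/injectiveP => A B; rewrite !ffunE => /eqP.
      by rewrite ker_f !rK => /eqP.
    by apply/ffunP=> x; rewrite !ffunE; apply/eqP; rewrite ker_f rK.
  rewrite inE => /injectiveP injg -> x y.
  by rewrite !ffunE (inj_eq injg).
by move/ffunP=> eq_gh; apply/ffunP=> B; have:= eq_gh (r B); rewrite !ffunE rK.
Qed.

Lemma expn_sum_partition (T : finType) (m : nat) :
  (m ^ #|T| = \sum_(P : {set {set T}} | partition P [set: T]) m ^_ #|P|)%N.
Proof.
rewrite -[in LHS](card_ord m) -card_ffun -sum1_card.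
rewrite (partition_big (fun f : {ffun T -> 'I_m} => preim_partition f [set: T])
  (fun P => partition P [set: T])) /= => [|f _]; last exact: preim_partitionP.
apply: eq_bigr => P /(card_preim_partition _ 'I_m); rewrite card_ord => <-.
by rewrite -sum1_card; apply: eq_bigl => f; rewrite inE.
Qed.

Lemma leq_card_partition (T : finType) (P : {set {set T}}) (D : {set T}) :
  partition P D -> (#|P| <= #|D|)%N.
Proof.
move=> partP; rewrite (card_partition partP) -sum1_card; apply: leq_sum => B PB.
by rewrite card_gt0; case/and3P: partP => _ _; apply: contraNneq => <-.
Qed.

Lemma derangement_sum (n : nat) :
  (derangement n)%:Z = \sum_(k < n.+1) (-1) ^+ k * ('C(n, k) * (n - k)`!)%:Z.
Proof.
(* Inclusion-exclusion: expand \prod_i (1 - [s i = i]) over the sets A of points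
   required to be fixed; (n - #|A|)! permutations fix A pointwise. *)
transitivity (\sum_(s : 'S_n) \prod_i ((- (s i == i)%:Z) + 1)).
  rewrite /derangement -sum1_card.
  rewrite (big_morph Posz PoszD (erefl _)) big_mkcond /=.
  apply: eq_bigr => s _; rewrite inE; case: ifPn => [/forallP ds|].
    by rewrite big1 // => i _; rewrite (negPf (ds i)) oppr0 add0r.
  rewrite negb_forall => /existsP[i]; rewrite negbK => si.
  by rewrite (bigD1 i) //= si mul0r.
under eq_bigr => s _ do rewrite bigA_distr.
rewrite exchange_big /=.
transitivity (\sum_(A in {set 'I_n}) (-1) ^+ #|A| * ((n - #|A|)`!)%:Z : int).
  apply: eq_bigr => A _.
  have -> : (n - #|A|)%N = #|~: A| by rewrite [RHS]cardsCs setCK card_ord.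
  rewrite -card_perm -[#|perm_on _|]sum1_card.
  rewrite (big_morph Posz PoszD (erefl _)) mulr_sumr big_mkcond /=.
  rewrite [RHS]big_mkcond /=.
  apply: eq_bigr => s _; rewrite -big_mkcond /=.
  rewrite /perm_on unfold_in /=; case: ifPn => [/subsetP sA|].
    rewrite mulr1 -prodr_const; apply: eq_bigr => i Ai.
    suff -> : s i == i by [].
    by apply: contraLR Ai => si; have := sA i si; rewrite inE.
  case/subsetPn=> i; rewrite !inE negbK => si Ai.
  by rewrite (bigD1 i) //= (negPf si) oppr0 mul0r.
(* Group the sets by cardinality; by [leA], [inord] never falls back to its default value. *)
rewrite (partition_big (fun A : {set 'I_n} => inord #|A| : 'I_n.+1) xpredT) //=.
apply: eq_bigr => k _.
have leA (A : {set 'I_n}) : (#|A| < n.+1)%N.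
  by rewrite ltnS -[n in (_ <= n)%N]card_ord max_card.
transitivity (\sum_(A in [set A : {set 'I_n} | #|A| == k])
    (-1) ^+ k * ((n - k)`!)%:Z : int).
  apply: eq_big => A; first by rewrite inE -val_eqE /= inordK.
  by rewrite -val_eqE /= inordK // => /eqP->.
rewrite sumr_const card_draws card_ord -mulrnAr; congr (_ * _).
by rewrite -mulr_natl natz PoszM.
Qed.

(** The last term of the sum gives the sign; the others match one by one, by (n + 1 - k) C(n + 1, k)
    = (n + 1) C(n, k). *)
Lemma derangementS (n : nat) :
  (derangement n.+1)%:Z = n.+1%:Z * (derangement n)%:Z + (-1) ^+ n.+1.
Proof.
rewrite !derangement_sum big_ord_recr /= binn subnn mulr1; congr (_ + _).
rewrite mulr_sumr; apply: eq_bigr => k _.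
rewrite mulrCA -PoszM; congr (_ * (Posz _)).
have le_kn : (k <= n)%N by rewrite -ltnS.
rewrite subSn // factS !mulnA -subSn //; congr (_ * _)%N.
by rewrite mulnC -mul_bin_down.
Qed.

Lemma derangement0 : derangement 0 = 1%N.
Proof.
by apply/eqP; rewrite -eqz_nat derangement_sum big_ord_recl big_ord0.
Qed.

Lemma sum_ffact (n k : nat) : (k.+1 * \sum_(j < n) j ^_ k = n ^_ k.+1)%N.
Proof.
elim: n => [|n IH]; first by rewrite big_ord0 muln0.
rewrite big_ord_recr mulnDr IH /= ffactSS ffactnSr mulnC -mulnDl.
(* [n - k] is truncated, so k > n is treated apart: there [n ^_ k] is 0. *)
have [le_kn|lt_nk] := leqP k n; last by rewrite ffact_small // !muln0.
by congr (_ * _)%N; lia.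
Qed.

(** The weight w_j for p = [q.+1]; the successor form lets sums over j < p be split at either
    end. *)
Definition bell_weight (q j : nat) : 'F_q.+1 :=
  (-1) ^+ (q.+1 - j) * (derangement (q - j))%:R.

Definition bell_moment (q k : nat) : 'F_q.+1 :=
  \sum_(j < q.+1) bell_weight q j * (j ^_ k)%:R.

Lemma bell_weightS (q j : nat) : prime q.+1 -> (j < q)%N ->
  bell_weight q j.+1 * j.+1%:R = bell_weight q j + 1.
Proof.
move=> q_prime lt_jq; rewrite /bell_weight.
have [d def_q] : exists d, q = (j + d).+1.
  by exists (q - j.+1)%N; lia.
have -> : (q - j = d.+1)%N by lia.
have -> : (q.+1 - j = d.+2)%N by lia.
have -> : (q - j.+1 = d)%N by lia.
have -> : (q.+1 - j.+1 = d.+1)%N by lia.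
(* As (j + 1) + (d + 1) = p, the factor j + 1 becomes, up to sign, the factor d + 1 of
   [derangementS]. *)
have -> : j.+1%:R = - d.+1%:R :> 'F_q.+1.
  apply/eqP; rewrite -subr_eq0 opprK -natrD.
  by rewrite (_ : _ + _ = q.+1)%N ?(pcharf0 (pchar_Fp q_prime)) //; lia.
have -> : (derangement d.+1)%:R =
    d.+1%:R * (derangement d)%:R + (-1) ^+ d.+1 :> 'F_q.+1.
  have /(congr1 (intr : int -> 'F_q.+1)) := derangementS d.
  by rewrite rmorphD rmorphM rmorphXn.
have sign2 : (-1) ^+ d.+1 * (-1) ^+ d.+1 = 1 :> 'F_q.+1.
  by rewrite -exprMn mulrNN mulr1 expr1n.
rewrite [(-1) ^+ d.+2]exprS mulrDr -[X in _ + X + _]mulrA sign2; ring.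
Qed.

Lemma bell_weight_last (q : nat) : bell_weight q q = -1.
Proof. by rewrite /bell_weight subnn derangement0 subSnn mulr1. Qed.

Lemma bell_momentS (q k : nat) : prime q.+1 -> (k < q)%N ->
  bell_moment q k.+1 = bell_moment q k.
Proof.
move=> q_prime lt_kq; rewrite /bell_moment big_ord_recl mulr0 add0r.
(* The shifted sum stops at j = q - 1, but the term j = q can be added since its weight is -1. *)
transitivity (\sum_(j < q.+1) (bell_weight q j + 1) * (j ^_ k)%:R).
  rewrite [RHS]big_ord_recr /= bell_weight_last addNr mul0r addr0.
  apply: eq_bigr => j _.
  by rewrite /bump /= add1n ffactSS natrM mulrA bell_weightS.
under eq_bigr => j _ do rewrite mulrDl mul1r.
rewrite big_split /= -natr_sum -[RHS]addr0; congr (_ + _).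
(* The sum of the [j ^_ k] is divisible by p: k + 1 is coprime to p, and k + 1 times the sum is
   [p ^_ k.+1], a multiple of p. *)
apply/eqP; rewrite -(dvdn_pcharf (pchar_Fp q_prime)).
rewrite -(Gauss_dvdr _ (_ : coprime _ k.+1)); last first.
  by rewrite prime_coprime // gtnNdvd.
by rewrite sum_ffact ffactSS dvdn_mulr.
Qed.

Lemma bell_moment_eq1 (q k : nat) : prime q.+1 -> (k <= q)%N ->
  bell_moment q k = 1.
Proof.
move=> q_prime; have top : bell_moment q q = 1.
  (* Only j = q contributes to the moment of order q, with value -(p - 1)!. *)
  rewrite /bell_moment big_ord_recr big1 /= => [|j _].
    rewrite bell_weight_last ffactnn add0r.
    apply/eqP; rewrite mulN1r eqr_oppLR -subr_eq0.
    rewrite opprK natr1 -(dvdn_pcharf (pchar_Fp q_prime)).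
    by rewrite -(Wilson (prime_gt1 q_prime)).
  by rewrite ffact_small ?mulr0.
move=> le_kq; have [d] : exists d, (k + d)%N = q by exists (q - k)%N; lia.
(* Descend from order q to order k, by induction on d = q - k. *)
elim: d k {le_kq} => [|d IH] k; first by rewrite addn0 => ->.
by rewrite addnS -addSn => def_q; rewrite -bell_momentS ?IH //; lia.
Qed.

Lemma bell_modp (q n : nat) : prime q.+1 -> (n <= q)%N ->
  (bell n)%:R = \sum_(j < q.+1) bell_weight q j * j%:R ^+ n.
Proof.
move=> q_prime le_nq; under eq_bigr => j _.
  rewrite -natrX -[n in (_ ^ n)%N]card_ord expn_sum_partition natr_sum.
  rewrite mulr_sumr.
over.
(* For each partition [P] the inner sum is the moment of order [#|P|], which is at most n. *)
rewrite exchange_big /= (eq_bigr (fun=> 1)) => [|P partP]; last first.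
  apply: bell_moment_eq1 => //.
  apply: leq_trans (leq_card_partition _ _ _ partP) _.
  by rewrite cardsT card_ord.
by rewrite /bell -sum1_card natr_sum; apply: eq_bigl => P; rewrite inE.
Qed.

Theorem mainTheorem2 (p : nat) (p_prime : prime p)
    (n : nat) (n_range : (1 <= n <= p - 1)%N) :
  ((bell n)%:Z =
     \sum_(1 <= m < p) (-1) ^+ m * (derangement m.-1)%:Z * (- m%:Z) ^+ n
     %[mod p%:Z])%Z.
Proof.
case: p p_prime n_range => // q p_prime; rewrite subn1 => /andP[n_gt0 le_nq].
apply/eqP; rewrite eqz_mod_dvd (dvdz_pcharf (pchar_Fp p_prime)).
rewrite rmorphB subr_eq0 rmorph_sum /= -pmulrn bell_modp //.
rewrite big_ord_recl expr0n eqn0Ngt n_gt0 mulr0 add0r.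
(* Reversing the order of summation realises m = p - j; what remains is -(p - j) = j in the
   field. *)
rewrite big_add1 big_nat_rev big_mkord /=; apply/eqP/eq_bigr => j _.
rewrite !rmorphM !rmorphXn !rmorphN rmorph1 /bump /= !add1n add0n.
rewrite /bell_weight -!pmulrn !subSS subnSK //; congr (_ * _ ^+ n).
apply/eqP; rewrite -subr_eq0 opprK -natrD addSn subnKC ?(ltnW (ltn_ord j)) //.
by rewrite (pcharf0 (pchar_Fp p_prime)).
Qed.
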